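(* Let $p$ be a prime, let $q\in\mathbb{C}_p$ with $|1-q|_p<1$, let $r\in\mathbb{N}$, $n\ge0$, $x\in\mathbb{Z}_p$, and let $w_1,w_2\in\mathbb{N}$ with $w_1\equiv 1 \pmod 2$ and $w_2\equiv 1\pmod 2$. Then \[ \sum_{i=0}^n\binom{n}{i}[w_1]_q^{n-i}[w_2]_q^{i}\,T^{(r)}_{n,i,q^{w_2}}(w_1)\,E^{(r)}_{n-i,q^{w_1}}(w_2x) =\sum_{i=0}^n\binom{n}{i}[w_1]_q^{i}[w_2]_q^{n-i}\,T^{(r)}_{n,i,q^{w_1}}(w_2)\,E^{(r)}_{n-i,q^{w_2}}(w_1x), \] where for $w\in\mathbb{N}$, \[ T^{(r)}_{n,i,q}(w)=\sum_{j_1,\dots,j_r=0}^{w-1}(-1)^{j_1+\cdots+j_r}q^{(n-i)(j_1+\cdots+j_r)}[j_1+\cdots+j_r]_q^{i}. \]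
   Context: $\mathbb{Z}_p$, $\mathbb{C}_p$ denote the $p$-adic integers and the completion of an algebraic closure of $\mathbb{Q}_p$. For $q\in\mathbb{C}_p$ with $|1-q|_p<1$, $[z]_q=\frac{1-q^z}{1-q}$. For continuous $f:\mathbb{Z}_p\to\mathbb{C}_p$, the fermionic $p$-adic integral is $\int_{\mathbb{Z}_p}f(y)\,d\mu_{-1}(y)=\lim_{N\to\infty}\sum_{y=0}^{p^N-1}f(y)(-1)^y$. The $q$-Euler polynomials of order $r$ are $E^{(r)}_{n,q}(z)=\int_{\mathbb{Z}_p}\cdots\int_{\mathbb{Z}_p}[z+y_1+\cdots+y_r]_q^n\,d\mu_{-1}(y_1)\cdots d\mu_{-1}(y_r)$ (equivalently, $\sum_{n\ge0}E^{(r)}_{n,q}(z)\frac{t^n}{n!}=2^r\sum_{m_1,\dots,m_r\ge0}(-1)^{m_1+\cdots+m_r}e^{[m_1+\cdots+m_r+z]_qt}$). *)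

(* Defs.v *)
From HB Require Import structures.
From mathcomp Require Import all_boot all_order all_algebra.
From mathcomp Require Import all_classical all_reals topology.

Set Implicit Arguments.
Unset Strict Implicit.
Unset Printing Implicit Defensive.

Import Order.TTheory GRing.Theory Num.Theory.

Local Open Scope classical_set_scope.
Local Open Scope ring_scope.

(* Fields with a non-archimedean absolute value, topologized by it. The normed
   structures of the library cannot be used here: they require
   [`|x *+ n| = `|x| *+ n], which fails p-adically. Only the topology layer is
   loaded, as the joins of these structures with the normed modules would
   otherwise have to be declared. *)
HB.mixin Record isUltrametric (R : realType) K
    & GRing.Field K & PseudoPointedMetric R K := {
  vabs : K -> R ;
  vabs_ge0 : forall x, 0 <= vabs x ;
  vabs_eq0 : forall x, (vabs x == 0) = (x == 0) ;
  vabsM : forall x y, vabs (x * y) = vabs x * vabs y ;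
  vabs_ultra : forall x y, vabs (x + y) <= Num.max (vabs x) (vabs y) ;
  ball_vabsE : forall (x : K) (e : R), ball x e = [set y : K | vabs (x - y) < e] }.

#[short(type="ultrametricFieldType")]
HB.structure Definition UltrametricField (R : realType) :=
  {K of GRing.Field K & PseudoPointedMetric R K & isUltrametric R K}.

#[short(type="completeUltrametricFieldType")]
HB.structure Definition CompleteUltrametricField (R : realType) :=
  {K of UltrametricField R K & Complete K}.

Section IntegerRing.
Variables (R : realType) (K : ultrametricFieldType R).

Definition integer_pred : {pred K} := [pred x | vabs x <= 1].

Fact vabs1 : vabs (1 : K) = 1.
Proof.
have nz : vabs (1 : K) != 0 by rewrite vabs_eq0 oner_eq0.
by apply: (mulfI nz); rewrite -vabsM !mulr1.
Qed.

Fact vabsN (x : K) : vabs (- x) = vabs x.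
Proof.
suff N1 : vabs (-1 : K) = 1 by rewrite -mulN1r vabsM N1 mul1r.
by apply/eqP; rewrite -sqrp_eq1 ?vabs_ge0// expr2 -vabsM mulrNN mulr1 vabs1.
Qed.

Fact integer_subring_closed : subring_closed integer_pred.
Proof.
split=> [|x y|x y]; rewrite !inE ?vabs1// => hx hy.
  by apply: le_trans (vabs_ultra x (- y)) _; rewrite ge_max hx vabsN.
by rewrite vabsM mulr_ile1 ?vabs_ge0.
Qed.

HB.instance Definition _ :=
  GRing.isSubringClosed.Build K integer_pred integer_subring_closed.

Record integer_ring := IntegerRing {
  integer_val : K ;
  integer_valP : integer_val \in integer_pred }.

HB.instance Definition _ := [isSub for integer_val].
HB.instance Definition _ := [Choice of integer_ring by <:].
HB.instance Definition _ := [SubChoice_isSubComNzRing of integer_ring by <:].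

End IntegerRing.

Definition padic_abs (R : realType) (p : nat) (a : rat) : R :=
  if a == 0 then 0
  else p%:R ^+ logn p `|denq a| / p%:R ^+ logn p `|numq a|.

Definition isometric (R : realType) (K L : ultrametricFieldType R)
  (f : K -> L) : Prop := forall x, vabs (f x) = vabs x.

(* [Qp] is a completion of the rationals for the p-adic absolute value,
   [Qpbar] an algebraic closure of [Qp] carrying the extension of its absolute
   value, and [Cp] a completion of [Qpbar]. These data are unique up to
   isometric isomorphism. *)
Record padic_tower (R : realType) (p : nat) := PadicTower {
  Qp : completeUltrametricFieldType R ;
  Qpbar : ultrametricFieldType R ;
  Cp : completeUltrametricFieldType R ;
  Qp_to_Qpbar : {rmorphism Qp -> Qpbar} ;
  Qpbar_to_Cp : {rmorphism Qpbar -> Cp} ;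
  Qp_vabs_rat : forall a : rat, vabs (ratr a : Qp) = padic_abs R p a ;
  Qp_rat_dense : dense (range (ratr : rat -> Qp)) ;
  Qp_to_Qpbar_isometric : isometric Qp_to_Qpbar ;
  Qpbar_algebraic : forall x : Qpbar, algebraicOver Qp_to_Qpbar x ;
  Qpbar_closed : GRing.closed_field_axiom Qpbar ;
  Qpbar_to_Cp_isometric : isometric Qpbar_to_Cp ;
  Cp_Qpbar_dense : dense (range Qpbar_to_Cp) }.

Section QEuler.
Variables (R : realType) (p : nat) (M : padic_tower R p).

Local Notation Cp := (Cp M).

Definition padic_int : comNzRingType := integer_ring (Qp M).

Definition padic_int_to_Cp (z : padic_int) : Cp := Qpbar_to_Cp M (Qp_to_Qpbar M (val z)).

Definition padic_binomial (z : padic_int) (k : nat) : Cp :=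
  (\prod_(i < k) (padic_int_to_Cp z - i%:R)) / k`!%:R.

(* [q ^ z] for a p-adic integer [z] and [|1 - q| < 1], as the binomial series of
   [(1 + (q - 1)) ^ z]: the continuous extension of [n |-> q ^+ n]. *)
Definition padic_power (q : Cp) (z : padic_int) : Cp :=
  limn (fun m : nat => \sum_(0 <= k < m) padic_binomial z k * (q - 1) ^+ k).

(* At [q = 1], where the quotient is 0 / 0, [z]_q is given its limit value [z].
   This case also occurs for [z]_(q ^+ w) when [q] is a root of unity. *)
Definition qnumber (q : Cp) (z : padic_int) : Cp :=
  if q == 1 then padic_int_to_Cp z else (1 - padic_power q z) / (1 - q).

Definition fermionic_integral (f : padic_int -> Cp) : Cp :=
  limn (fun N : nat => \sum_(0 <= y < p ^ N) f y%:R * (-1) ^+ y).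

(* The first coordinate is the innermost variable of integration. *)
Fixpoint iterated_integral (r : nat) : (r.-tuple padic_int -> Cp) -> Cp :=
  match r with
  | 0 => fun F => F [tuple]
  | r'.+1 => fun F => fermionic_integral (fun y =>
      iterated_integral (fun t : r'.-tuple padic_int => F [tuple of rcons t y]))
  end.

Definition qEuler (r n : nat) (q : Cp) (z : padic_int) : Cp :=
  iterated_integral (fun y : r.-tuple padic_int =>
    qnumber q (z + \sum_(i < r) tnth y i) ^+ n).

Definition Tsum (r n i : nat) (q : Cp) (w : nat) : Cp :=
  \sum_(j : {ffun 'I_r -> 'I_w})
    (-1) ^+ (\sum_(k < r) j k) * q ^+ ((n - i) * \sum_(k < r) j k)
      * qnumber q (\sum_(k < r) j k)%:R ^+ i.

End QEuler.

(* Main.v *)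
Require Import Defs.
From mathcomp Require Import all_boot all_order all_algebra.
From mathcomp Require Import all_classical all_reals topology.
From mathcomp Require Import ring lra.

(** Put [(S_w g) z = \int g (z + w y) dmu(y)].  Since [[w1]_q [z]_{q^w1} = [w1 z]_q]
    and [[a + y]_q = [a]_q + q^a [y]_q], the binomial formula turns the left-hand
    side into the [r]-th iterate, applied to [y |-> [y]_q^n] at [w1 w2 x], of
    [g |-> \sum_(j < w1) (-1)^j (S_w1 g) (z + w2 j)].  For odd [w2],
    [\int f = \sum_(k < w2) (-1)^k \int f (k + w2 y) dmu(y)], so this operator is
    [\sum_(j < w1, k < w2) (-1)^(j + k) (S_(w1 w2) g) (z + w2 j + w1 k)], which is
    symmetric in [w1] and [w2].  For [p = 2] all integrals vanish. *)

Set Implicit Arguments.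
Unset Strict Implicit.
Unset Printing Implicit Defensive.

Import Order.TTheory GRing.Theory Num.Theory.

Local Open Scope classical_set_scope.
Local Open Scope ring_scope.

(** Bernoulli's inequality for [a^-1 = 1 + h] makes the inverse powers of [a] grow at least
    linearly, so the archimedean property of [R] yields [N]. *)
Lemma geometric_small (R : realType) (a e : R) :
  0 <= a -> a < 1 -> 0 < e ->
  exists N, forall n, (N <= n)%N -> a ^+ n <= e.
Proof.
move=> a0 a1 e0.
suff [N aN] : exists N, a ^+ N <= e.
  exists N => n Nn; apply: le_trans aN.
  by rewrite -(subnK Nn) exprD ler_piMl ?exprn_ge0 ?exprn_ile1 // ltW.
have [->|an0] := eqVneq a 0; first by exists 1%N; rewrite expr1 ltW.
have ap : 0 < a by rewrite lt_def an0.
pose h := a^-1 - 1.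
have hp : 0 < h by rewrite subr_gt0 invf_gt1.
have ah : a^-1 = 1 + h by rewrite /h; ring.
have bern n : 1 + n%:R * h <= (1 + h) ^+ n.
  elim: n => [|n IH]; first by rewrite mul0r addr0 expr0.
  rewrite exprS; have : (1 + h) * (1 + n%:R * h) <= (1 + h) * (1 + h) ^+ n.
    by rewrite ler_wpM2l //; lra.
  apply: le_trans; rewrite -natr1.
  have : 0 <= n%:R * h ^+ 2 by rewrite mulr_ge0 ?ler0n // exprn_ge0 // ltW.
  by nra.
have [N hN] : exists N : nat, e^-1 / h < N%:R.
  by exists (Num.bound (e^-1 / h)); apply: archi_boundP; rewrite divr_ge0 ?invr_ge0 ?ltW.
exists N; rewrite -[a]invrK exprVn -[e]invrK lef_pV2 ?posrE ?invr_gt0 ?exprn_gt0 ?invr_gt0//.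
by rewrite ah; apply: le_trans (bern N); move: hN; rewrite ltr_pdivrMr //; lra.
Qed.

(** * Ultrametric limits *)

Section Ultrametric.
Context {R : realType} {K : ultrametricFieldType R}.
Implicit Types (x y z : K) (e : R) (u v : nat -> K) (l m : K).

Lemma vabs0 : vabs (0 : K) = 0.
Proof. by apply/eqP; rewrite vabs_eq0. Qed.

Lemma vabs_distC x y : vabs (x - y) = vabs (y - x).
Proof. by rewrite -vabsN opprB. Qed.

Lemma vabsD_le e x y : vabs x <= e -> vabs y <= e -> vabs (x + y) <= e.
Proof. by move=> xe ye; apply: le_trans (vabs_ultra x y) _; rewrite ge_max xe. Qed.

Lemma vabsB_le e x y : vabs x <= e -> vabs y <= e -> vabs (x - y) <= e.
Proof. by move=> xe ye; apply: vabsD_le; rewrite ?vabsN. Qed.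

Lemma vabs_dist_trans y e x z :
  vabs (x - y) <= e -> vabs (y - z) <= e -> vabs (x - z) <= e.
Proof. by move=> xy yz; rewrite -(subrK y x) -addrA vabsD_le. Qed.

Lemma vabs_sum_le (I : Type) (s : seq I) (P : pred I) (F : I -> K) e :
  0 <= e -> (forall i, P i -> vabs (F i) <= e) ->
  vabs (\sum_(i <- s | P i) F i) <= e.
Proof.
move=> e0 Fe; elim/big_ind: _ => //; first by rewrite vabs0.
by move=> x y; apply: vabsD_le.
Qed.

Lemma vabsX x n : vabs (x ^+ n) = vabs x ^+ n.
Proof. by elim: n => [|n IH]; rewrite ?expr0 ?vabs1// !exprS vabsM IH. Qed.

Lemma vabsV x : vabs x^-1 = (vabs x)^-1.
Proof.
have [->|x0] := eqVneq x 0; first by rewrite invr0 vabs0 invr0.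
have vx0 : vabs x != 0 by rewrite vabs_eq0.
by apply: (mulfI vx0); rewrite -vabsM !divff // vabs1.
Qed.

Lemma vabs_sign n : vabs ((-1 : K) ^+ n) = 1.
Proof. by rewrite vabsX vabsN vabs1 expr1n. Qed.

Lemma vabs_nat n : vabs (n%:R : K) <= 1.
Proof. by have := rpred_nat (@integer_pred R K) n; rewrite inE. Qed.

Lemma vabs_int (n : int) : vabs (n%:~R : K) <= 1.
Proof. by have := rpred_int (@integer_pred R K) n; rewrite inE. Qed.

Lemma vabs_small_eq x y : (forall e, 0 < e -> vabs (x - y) <= e) -> x = y.
Proof.
move=> xy; apply/eqP; rewrite -subr_eq0 -vabs_eq0 eq_le vabs_ge0 andbT.
by apply/ler_addgt0Pl => e e0; rewrite addr0; apply: xy.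
Qed.

(** The bound is non-strict and read off [vabs]: by the ultrametric inequality, sums and chains of
    such estimates keep the same [e]. *)
Definition vcvg u l :=
  forall e, 0 < e -> exists N, forall n, (N <= n)%N -> vabs (u n - l) <= e.

Lemma vcvg_uniq u l m : vcvg u l -> vcvg u m -> l = m.
Proof.
move=> ul um; apply: vabs_small_eq => e e0.
have [N1 N1P] := ul _ e0; have [N2 N2P] := um _ e0.
apply: (@vabs_dist_trans (u (maxn N1 N2))).
  by rewrite vabs_distC N1P // leq_maxl.
by rewrite N2P // leq_maxr.
Qed.

Lemma ultrametric_hausdorff : hausdorff_space K.
Proof.
move=> x y xy; apply: vabs_small_eq => e e0.
have /xy : nbhs x (ball x e) by apply: nbhsx_ballx.
move=> /(_ _ (nbhsx_ballx y e e0)) [z []].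
rewrite !ball_vabsE /= => xz yz.
by apply: (@vabs_dist_trans z); rewrite 1?(vabs_distC z) ltW.
Qed.

Lemma vcvg_limn u l : vcvg u l -> limn u = l.
Proof.
move=> ul; apply: (cvg_lim ultrametric_hausdorff).
apply/cvg_ballP => e e0.
have [|N NP] := ul (e / 2); first by rewrite divr_gt0.
exists N => // n /= Nn; rewrite ball_vabsE /= vabs_distC.
by apply: le_lt_trans (NP n Nn) _; rewrite ltr_pdivrMr // ltr_pMr // ltr1n.
Qed.

Lemma eq_vcvg u v l : u =1 v -> vcvg u l -> vcvg v l.
Proof. by move=> /funext ->. Qed.

Lemma vcvg_cst l : vcvg (fun=> l) l.
Proof. by move=> e /ltW e0; exists 0%N => n _; rewrite subrr vabs0. Qed.

Lemma vcvgD u v l m : vcvg u l -> vcvg v m -> vcvg (fun n => u n + v n) (l + m).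
Proof.
move=> ul vm e e0; have [N1 N1P] := ul _ e0; have [N2 N2P] := vm _ e0.
exists (maxn N1 N2) => n; rewrite geq_max => /andP[n1 n2].
by rewrite opprD addrACA vabsD_le // ?N1P ?N2P.
Qed.

Lemma vcvgZ a u l : vcvg u l -> vcvg (fun n => a * u n) (a * l).
Proof.
move=> ul e e0; have b0 : 0 < vabs a + 1 by rewrite ltr_wpDl ?vabs_ge0.
have [|N NP] := ul (e / (vabs a + 1)); first by rewrite divr_gt0.
exists N => n Nn; rewrite -mulrBr vabsM.
apply: (@le_trans _ _ ((vabs a + 1) * (e / (vabs a + 1)))).
  by rewrite ler_pM ?vabs_ge0 ?NP // lerDl.
by rewrite mulrC divfK // gt_eqF.
Qed.

Lemma vcvg_sum (I : Type) (s : seq I) (u : I -> nat -> K) (l : I -> K) :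
  (forall i, vcvg (u i) (l i)) ->
  vcvg (fun n => \sum_(i <- s) u i n) (\sum_(i <- s) l i).
Proof.
move=> ul; elim: s => [|i s IH].
  by rewrite big_nil; apply: eq_vcvg (vcvg_cst 0) => n; rewrite big_nil.
rewrite big_cons; apply: eq_vcvg (vcvgD (ul i) IH) => n.
by rewrite big_cons.
Qed.

Lemma vcvg_dist_le u v l m e : 0 < e ->
  (exists N, forall n, (N <= n)%N -> vabs (u n - v n) <= e) ->
  vcvg u l -> vcvg v m -> vabs (l - m) <= e.
Proof.
move=> e0 [N NP] ul vm; have [N1 N1P] := ul _ e0; have [N2 N2P] := vm _ e0.
pose n := maxn N (maxn N1 N2).
apply: (@vabs_dist_trans (u n)).
  by rewrite vabs_distC N1P // /n; rewrite !leq_max leqnn orbT.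
apply: (@vabs_dist_trans (v n)); first by rewrite NP // /n leq_max leqnn.
by rewrite N2P // /n !leq_max leqnn !orbT.
Qed.

Lemma vcvg_near u v l :
  (forall e, 0 < e -> exists N, forall n, (N <= n)%N -> vabs (v n - u n) <= e) ->
  vcvg u l -> vcvg v l.
Proof.
move=> uv ul e e0; have [N1 N1P] := uv _ e0; have [N2 N2P] := ul _ e0.
exists (maxn N1 N2) => n; rewrite geq_max => /andP[n1 n2].
by apply: (@vabs_dist_trans (u n)); rewrite ?N1P ?N2P.
Qed.

End Ultrametric.

Arguments vabs_dist_trans {R K} y {e x z}.

(** Small consecutive differences already make the sequence Cauchy, since a telescoping sum is no
    larger than its largest term. *)
Lemma vcauchy_cvg (R : realType) (K : completeUltrametricFieldType R) (u : nat -> K) :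
  (forall e : R, 0 < e ->
     exists N, forall n, (N <= n)%N -> vabs (u n.+1 - u n) <= e) ->
  exists l, vcvg u l.
Proof.
move=> cu.
have cu' (e : R) : 0 < e -> exists N, forall n, (N <= n)%N -> vabs (u n - u N) <= e.
  move=> e0; have [N NP] := cu _ e0; exists N; elim=> [|n IH].
    by rewrite leqn0 => /eqP ->; rewrite subrr vabs0 ltW.
  rewrite leq_eqVlt => /predU1P[->|Nn]; first by rewrite subrr vabs0 ltW.
  by apply: (vabs_dist_trans (u n)); rewrite ?NP ?IH.
have /cauchy_cvg ul : cauchy (u @ \oo).
  apply: cauchy_exP => e e0.
  have [|N NP] := cu' (e / 2); first by rewrite divr_gt0.
  exists (u N), N => // n /= Nn; rewrite ball_vabsE /= vabs_distC.
  by apply: le_lt_trans (NP n Nn) _; rewrite ltr_pdivrMr // ltr_pMr // ltr1n.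
exists (limn u) => e e0.
have /cvg_ballP /(_ e e0) [N _ NP] := ul.
exists N => n Nn; have := NP n Nn; rewrite ball_vabsE /= vabs_distC.
exact: ltW.
Qed.

(** * Uniformly continuous functions on the p-adic integers *)

Section PadicIntegers.
Context {R : realType} {p : nat} (p_prime : prime p) {M : padic_tower R p}.

Local Notation Zp := (padic_int M).
Local Notation Cp := (Cp M).
Local Notation iota := (@padic_int_to_Cp R p M).
Implicit Types (x y z u : Zp) (f g : Zp -> Cp) (e : R) (N m n k w : nat) (q : Cp).

(** * Absolute values of integers in [Qp] and [Cp] *)

Lemma vabs_Qp_int (a : int) : a != 0 ->
  vabs (a%:~R : Qp M) = (p%:R ^+ logn p `|a|)^-1.
Proof.
move=> a0; rewrite -ratr_int Qp_vabs_rat /padic_abs intr_eq0 (negPf a0).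
by rewrite numq_int denq_int logn1 expr0 mul1r.
Qed.

Lemma vabs_Qp_p_expn N : vabs ((p ^ N)%:R : Qp M) = (p%:R ^+ N)^-1.
Proof.
rewrite [in LHS]pmulrn vabs_Qp_int; last by rewrite -lt0n expn_gt0 prime_gt0.
by rewrite absz_nat pfactorK.
Qed.

Lemma vabs_Cp_nat n : vabs (n%:R : Cp) = vabs (n%:R : Qp M).
Proof.
have -> : n%:R = Qpbar_to_Cp M (Qp_to_Qpbar M n%:R) by rewrite !rmorph_nat.
by rewrite Qpbar_to_Cp_isometric Qp_to_Qpbar_isometric.
Qed.

Lemma natr_Cp_eq0 n : ((n%:R : Cp) == 0) = (n == 0)%N.
Proof.
case: n => [|n]; first by rewrite !eqxx.
rewrite -vabs_eq0 vabs_Cp_nat pmulrn vabs_Qp_int //.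
by rewrite invr_eq0 expf_eq0 pnatr_eq0 [p == 0%N](gtn_eqF (prime_gt0 p_prime)) andbF.
Qed.

Lemma vabs_Cp_p_lt1 : vabs (p%:R : Cp) < 1.
Proof.
rewrite vabs_Cp_nat -[p in p%:R]expn1 vabs_Qp_p_expn expr1 invf_lt1 ?ltr0n ?prime_gt0//.
by rewrite ltr1n prime_gt1.
Qed.

Lemma padic_int_to_CpD x y : iota (x + y) = iota x + iota y.
Proof. by rewrite /iota /= !rmorphD. Qed.

Lemma padic_int_to_CpM x y : iota (x * y) = iota x * iota y.
Proof. by rewrite /iota /= !rmorphM. Qed.

Lemma padic_int_to_Cp_nat n : iota n%:R = n%:R.
Proof.
elim: n => [|n IH]; first by rewrite /iota /= !rmorph0.
by rewrite -!natr1 padic_int_to_CpD IH /iota /= !rmorph1.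
Qed.

Lemma vabs_padic_int z : vabs (iota z) <= 1.
Proof.
by rewrite Qpbar_to_Cp_isometric Qp_to_Qpbar_isometric; have := valP z; rewrite inE.
Qed.

(** * Density of the natural numbers in the p-adic integers *)

(** If [p] divides the denominator of a reduced fraction, it does not divide the numerator, and the
    absolute value exceeds 1. *)
Lemma coprime_denq_padic (a : rat) :
  vabs (ratr a : Qp M) <= 1 -> coprime p `|denq a|.
Proof.
rewrite Qp_vabs_rat /padic_abs; have [->|a0] := eqVneq a 0.
  by rewrite (denq_int 0) coprimen1.
rewrite prime_coprime // => a1; apply/negP => pd.
have pn : logn p `|numq a| = 0%N.
  apply: logn_coprime; apply: (coprime_dvdl pd).
  by rewrite coprime_sym coprime_num_den.
move: a1; rewrite pn expr0 divr1 leNgt; case/negP.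
rewrite -natrX ltr1n -[1%N](expn0 p) ltn_exp2l ?prime_gt1//.
by rewrite logn_gt0 mem_primes p_prime pd absz_gt0 denq_eq0.
Qed.

(** A rational [a] close to [z] has absolute value at most 1, hence a denominator prime to [p], so
    it is congruent to a natural number [n] modulo [p ^ N]. The quotient of [z - n] by [p ^ N] is
    then again integral. *)
Lemma padic_int_nat_approx z N : exists n u, z = n%:R + (p ^ N)%:R * u.
Proof.
have P0 : (0 : R) < (p%:R ^+ N)^-1.
  by rewrite invr_gt0 exprn_gt0 // ltr0n prime_gt0.
have [a za] : exists a : rat, vabs (val z - ratr a) < (p%:R ^+ N)^-1.
  have zb := nbhsx_ballx (val z : Qp M) _ P0.
  have [||b [/interior_subset zb' [a _ ab]]] := @Qp_rat_dense R p M (ball (val z : Qp M) (p%:R ^+ N)^-1)°.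
  - by exists (val z).
  - exact: open_interior.
  by exists a; move: zb'; rewrite ball_vabsE /= -ab.
have a1 : vabs (ratr a : Qp M) <= 1.
  rewrite -[ratr a](subKr (val z)) vabsB_le //; first by have := valP z; rewrite inE.
  apply: le_trans (ltW za) _; rewrite invf_le1 ?exprn_gt0 ?ltr0n ?prime_gt0//.
  by rewrite -natrX ler1n expn_gt0 prime_gt0.
have den1 : vabs ((denq a)%:~R : Qp M) = 1.
  rewrite vabs_Qp_int ?denq_eq0//.
  have := coprime_denq_padic a1; rewrite prime_coprime // => pd.
  by rewrite logn_coprime ?prime_coprime// expr0 invr1.
have [n [b nb]] : exists (n : nat) (b : int),
    numq a - n%:Z * denq a = (p ^ N)%:Z * b.
  have : coprimez (p ^ N)%:Z (denq a).
    by rewrite coprimezE absz_nat coprimeXl // coprime_denq_padic.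
  move=> /coprimezP [[s t] /= st].
  (* From [s * p ^ N + t * denq a = 1], [t] inverts [denq a] modulo [p ^ N]. The number [n] is the
     residue of [c], and [b] collects the multiples of [P]. *)
  pose c := numq a * t; pose P := (p ^ N)%:Z.
  have P1 : P != 0 by rewrite -lt0n expn_gt0 prime_gt0.
  exists `|(c %% P)%Z|%N, (numq a * s + (c %/ P)%Z * denq a).
  have -> : (`|(c %% P)%Z|%N : int) = (c %% P)%Z by rewrite gez0_abs // modz_ge0.
  have cE := divz_eq c P.
  have -> : (c %% P)%Z = c - (c %/ P)%Z * P by rewrite {2}cE; ring.
  rewrite -/P /c -{1}[numq a]mulr1 -st -/P; ring.
have zn : vabs (val z - n%:R) <= (p%:R ^+ N)^-1.
  apply: (vabs_dist_trans (ratr a)); first exact: ltW.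
  have d0 : (denq a)%:~R != 0 :> Qp M by rewrite -vabs_eq0 den1 oner_eq0.
  have -> : ratr a - n%:R = (p ^ N)%:R * b%:~R / (denq a)%:~R :> Qp M.
    apply: (mulIf d0); rewrite mulrBl !divfK //.
    by rewrite (pmulrn 1 n) -intrM -intrB nb intrM.
  rewrite !vabsM vabsV den1 invr1 mulr1 vabs_Qp_p_expn.
  by rewrite ler_piMr ?vabs_int // ltW.
have P0' : (p ^ N)%:R != 0 :> Qp M.
  by rewrite -vabs_eq0 vabs_Qp_p_expn gt_eqF.
have u1 : (val z - n%:R) / (p ^ N)%:R \in @integer_pred R (Qp M).
  rewrite inE vabsM vabsV vabs_Qp_p_expn invrK.
  by rewrite -ler_pdivlMr ?div1r // -invr_gt0.
exists n, (IntegerRing u1); apply: val_inj.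
by rewrite rmorphD rmorphM !rmorph_nat /= mulrC divfK // addrC subrK.
Qed.

(* Uniform continuity, with the neighbourhoods of 0 given as the ideals
   [p ^ N * Zp]: no metric on [Zp] is needed. *)
Definition padic_uc f :=
  forall e, 0 < e -> exists N, forall x u, vabs (f (x + (p ^ N)%:R * u) - f x) <= e.

Lemma padic_uc_mono f e N N' : (N <= N')%N ->
  (forall x u, vabs (f (x + (p ^ N)%:R * u) - f x) <= e) ->
  forall x u, vabs (f (x + (p ^ N')%:R * u) - f x) <= e.
Proof. by move=> NN' fN x u; rewrite -(subnKC NN') expnD natrM -mulrA. Qed.

Lemma padic_uc_joint f g e : padic_uc f -> padic_uc g -> 0 < e ->
  exists N, (forall x u, vabs (f (x + (p ^ N)%:R * u) - f x) <= e) /\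
            (forall x u, vabs (g (x + (p ^ N)%:R * u) - g x) <= e).
Proof.
move=> fu gu e0; have [N1 N1P] := fu _ e0; have [N2 N2P] := gu _ e0.
exists (maxn N1 N2); split.
  exact: padic_uc_mono (leq_maxl _ _) N1P.
exact: padic_uc_mono (leq_maxr _ _) N2P.
Qed.

(** Density of the natural numbers; this reduces the laws of [padic_power] to those of ordinary
    powers. *)
Lemma padic_uc_ext_nat f g : padic_uc f -> padic_uc g ->
  (forall n, f n%:R = g n%:R) -> forall z, f z = g z.
Proof.
move=> fu gu fg z; apply: vabs_small_eq => e e0.
have [N [fN gN]] := padic_uc_joint fu gu e0.
have [n [u ->]] := padic_int_nat_approx z N.
apply: (vabs_dist_trans (f n%:R)); first exact: fN.
by rewrite fg vabs_distC gN.
Qed.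

(** For some [N] the values vary by at most 1 on each class modulo [p ^ N], and finitely many
    residues represent all classes. *)
Lemma padic_uc_bounded f : padic_uc f -> exists2 B : R, 0 < B & forall x, vabs (f x) <= B.
Proof.
move=> /(_ 1 ltr01) [N NP].
pose S := \sum_(i < p ^ N) vabs (f (i : nat)%:R).
have S0 : 0 <= S by apply: sumr_ge0 => i _; apply: vabs_ge0.
exists (1 + S); first by rewrite ltr_pwDl.
move=> x; have [n [u ->]] := padic_int_nat_approx x N.
have P0 : (0 < p ^ N)%N by rewrite expn_gt0 prime_gt0.
(* The quotient of [n] by [p ^ N] is absorbed into the multiple of [p ^ N], leaving the residue as
   base point. *)
rewrite (divn_eq n (p ^ N)) natrD natrM [_%:R * (p ^ N)%:R]mulrC addrAC -mulrDr addrC.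
set u' := (_ + u); set m := (n %% _)%N.
have mP : (m < p ^ N)%N by rewrite ltn_mod.
rewrite -[f _](subrK (f m%:R)); apply: vabsD_le.
  by apply: le_trans (NP _ _) _; rewrite lerDl.
apply: (@le_trans _ _ S); last by rewrite lerDr.
rewrite /S (bigD1 (Ordinal mP)) //= lerDl; apply: sumr_ge0 => i _; exact: vabs_ge0.
Qed.

Lemma padic_uc_cst c : padic_uc (fun=> c).
Proof. by move=> e e0; exists 0%N => x u; rewrite subrr vabs0 ltW. Qed.

Lemma padic_ucD f g : padic_uc f -> padic_uc g -> padic_uc (fun x => f x + g x).
Proof.
move=> fu gu e e0; have [N [fN gN]] := padic_uc_joint fu gu e0.
by exists N => x u; rewrite opprD addrACA vabsD_le.
Qed.

Lemma padic_ucM f g : padic_uc f -> padic_uc g -> padic_uc (fun x => f x * g x).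
Proof.
move=> fu gu e e0; have [B B0 fB] := padic_uc_bounded fu.
have [C C0 gC] := padic_uc_bounded gu.
have e' : 0 < e / (B + C) by rewrite divr_gt0 // addr_gt0.
have [N [fN gN]] := padic_uc_joint fu gu e'.
exists N => x u; set y := x + _.
have -> : f y * g y - f x * g x = (f y - f x) * g y + f x * (g y - g x) by ring.
have eE : e = e / (B + C) * (B + C) by rewrite divfK // gt_eqF // addr_gt0.
apply: vabsD_le; rewrite vabsM eE.
  apply: (@le_trans _ _ (e / (B + C) * C)); first by rewrite ler_pM ?vabs_ge0 ?fN.
  by rewrite ler_wpM2l ?lerDr // ltW.
rewrite mulrC; apply: (@le_trans _ _ (e / (B + C) * B)).
  by rewrite ler_pM ?vabs_ge0 ?gN.
by rewrite ler_wpM2l ?lerDl // ltW.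
Qed.

Lemma padic_ucX f n : padic_uc f -> padic_uc (fun x => f x ^+ n).
Proof.
move=> fu; elim: n => [|n IH]; first exact: padic_uc_cst.
rewrite (_ : (fun x => f x ^+ n.+1) = (fun x => f x * f x ^+ n)).
  exact: padic_ucM.
by apply/funext => x; rewrite exprS.
Qed.

Lemma padic_uc_sum (I : Type) (s : seq I) (F : I -> Zp -> Cp) :
  (forall i, padic_uc (F i)) -> padic_uc (fun x => \sum_(i <- s) F i x).
Proof.
move=> Fu; elim: s => [|i s IH].
  rewrite (_ : (fun x => _) = (fun=> 0)); first exact: padic_uc_cst.
  by apply/funext => x; rewrite big_nil.
rewrite (_ : (fun x => _) = (fun x => F i x + \sum_(j <- s) F j x)).
  exact: padic_ucD.
by apply/funext => x; rewrite big_cons.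
Qed.

Lemma padic_uc_affine f z c : padic_uc f -> padic_uc (fun x => f (z + c * x)).
Proof.
move=> fu e e0; have [N NP] := fu _ e0.
by exists N => x u; rewrite mulrDr addrA mulrCA.
Qed.

Lemma padic_uc_limit f :
  (forall e, 0 < e -> exists2 g, padic_uc g & forall x, vabs (f x - g x) <= e) ->
  padic_uc f.
Proof.
move=> fl e e0; have [g gu fg] := fl _ e0; have [N NP] := gu _ e0.
exists N => x u; apply: (vabs_dist_trans (g (x + (p ^ N)%:R * u))) => //.
by apply: (vabs_dist_trans (g x)); rewrite // vabs_distC.
Qed.

Lemma padic_uc_to_Cp : padic_uc iota.
Proof.
move=> e e0; have [N NP] := geometric_small (vabs_ge0 _) vabs_Cp_p_lt1 e0.
exists N => x u; rewrite padic_int_to_CpD addrAC subrr add0r padic_int_to_CpM vabsM.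
rewrite padic_int_to_Cp_nat natrX vabsX; apply: le_trans (NP N (leqnn _)).
by rewrite ler_piMr ?exprn_ge0 ?vabs_ge0 ?vabs_padic_int.
Qed.

(** * Binomial coefficients of p-adic integers *)

Lemma padic_uc_binomial k : padic_uc (fun z => padic_binomial z k).
Proof.
apply: padic_ucM; last exact: padic_uc_cst.
elim: k => [|k IH].
  rewrite (_ : (fun z => _) = (fun=> 1)); first exact: padic_uc_cst.
  by apply/funext => z; rewrite big_ord0.
rewrite (_ : (fun z => _) = (fun z => \prod_(i < k) (iota z - i%:R) * (iota z - k%:R))).
  by apply: padic_ucM => //; apply: padic_ucD padic_uc_to_Cp (padic_uc_cst _).
by apply/funext => z; rewrite big_ord_recr.
Qed.

Lemma padic_binomial_nat n k : padic_binomial (n%:R : Zp) k = 'C(n, k)%:R.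
Proof.
rewrite /padic_binomial padic_int_to_Cp_nat.
have k0 : (k`!%:R : Cp) != 0 by rewrite natr_Cp_eq0 -lt0n fact_gt0.
apply: (mulIf k0); rewrite divfK // -natrM bin_ffact.
elim: k {k0} => [|k IH]; first by rewrite big_ord0 ffactn0.
rewrite big_ord_recr /= IH ffactnSr natrM.
have [kn|nk] := leqP k n; first by rewrite natrB.
by rewrite ffact_small // !mul0r.
Qed.

(** At natural numbers the value is an integer; density and the ultrametric inequality carry the
    bound over to all [z]. *)
Lemma vabs_padic_binomial z k : vabs (padic_binomial z k) <= 1.
Proof.
have [N NP] := padic_uc_binomial k (@ltr01 R).
have [n [u ->]] := padic_int_nat_approx z N.
rewrite -[padic_binomial _ _](subrK (padic_binomial n%:R k)) vabsD_le //.
by rewrite padic_binomial_nat vabs_nat.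
Qed.

(** * Powers and q-numbers *)

(** The [k]-th term is at most [vabs (q - 1) ^+ k] for every [z], so [N] does not depend on [z].
    This uniformity makes [padic_power q] uniformly continuous. *)
Lemma padic_power_approx q e : vabs (1 - q) < 1 -> 0 < e ->
  exists N, forall z,
    vabs (padic_power q z - \sum_(0 <= k < N) padic_binomial z k * (q - 1) ^+ k) <= e.
Proof.
move=> hq e0.
have q1 : vabs (q - 1) < 1 by rewrite vabs_distC.
have [N NP] := geometric_small (vabs_ge0 _) q1 e0; exists N => z.
pose S n := \sum_(0 <= k < n) padic_binomial z k * (q - 1) ^+ k.
have term k : vabs (padic_binomial z k * (q - 1) ^+ k) <= vabs (q - 1) ^+ k.
  by rewrite vabsM vabsX ler_piMl ?exprn_ge0 ?vabs_ge0 ?vabs_padic_binomial.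
have [l Sl] : exists l, vcvg S l.
  apply: vcauchy_cvg => d d0.
  have [N' N'P] := geometric_small (vabs_ge0 _) q1 d0; exists N' => n N'n.
  rewrite /S big_nat_recr //= addrAC subrr add0r.
  exact: le_trans (term n) (N'P n N'n).
rewrite /padic_power (vcvg_limn Sl).
apply: (vcvg_dist_le e0 _ Sl (vcvg_cst _)); exists N => n Nn.
rewrite /S (big_cat_nat _ Nn) //= addrAC subrr add0r big_nat.
by apply: vabs_sum_le => [|i /andP[Ni _]]; [exact: ltW | exact: le_trans (term i) (NP i Ni)].
Qed.

Lemma padic_uc_power q : vabs (1 - q) < 1 -> padic_uc (padic_power (M := M) q).
Proof.
move=> hq; apply: padic_uc_limit => e e0.
have [N NP] := padic_power_approx hq e0.
exists (fun z => \sum_(0 <= k < N) padic_binomial z k * (q - 1) ^+ k) => //.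
apply: padic_uc_sum => k.
exact: (padic_ucM (padic_uc_binomial k) (padic_uc_cst _)).
Qed.

(** The series terminates: from [n.+1] terms on, the partial sums are the binomial expansion of
    [(1 + (q - 1)) ^+ n]. *)
Lemma padic_power_nat q n : padic_power q (n%:R : Zp) = q ^+ n.
Proof.
apply: vcvg_limn => e e0; exists n.+1 => m nm.
rewrite (big_cat_nat _ nm) //= [X in _ + X - _]big_nat [X in _ + X - _]big1 => [|k /andP[nk _]]; last first.
  by rewrite padic_binomial_nat // bin_small // mul0r.
rewrite addr0 big_mkord -[q in q ^+ n](subrKC 1) exprDn.
rewrite -sumrB big1 ?vabs0 ?ltW// => i _.
by rewrite padic_binomial_nat // expr1n mul1r mulr_natl subrr.
Qed.

Lemma vabs_le1_of_near1 q : vabs (1 - q) < 1 -> vabs q <= 1.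
Proof. by move=> hq; rewrite -[q](subKr 1) vabsB_le ?vabs1 // ltW. Qed.

Lemma vabs_one_sub_expr q w : vabs (1 - q) < 1 -> vabs (1 - q ^+ w) < 1.
Proof.
move=> hq; apply: le_lt_trans (hq); rewrite -[1 in X in X <= _](expr1n _ w) subrXX vabsM.
rewrite ler_piMr ?vabs_ge0 // vabs_sum_le // => i _.
by rewrite expr1n mul1r vabsX exprn_ile1 ?vabs_ge0 // vabs_le1_of_near1.
Qed.

Lemma padic_power_natD q n z : vabs (1 - q) < 1 ->
  padic_power q (n%:R + z) = q ^+ n * padic_power q z.
Proof.
move=> hq; move: z; apply: padic_uc_ext_nat.
- have := padic_uc_affine n%:R 1 (padic_uc_power hq).
  by under eq_fun do rewrite mul1r.
- exact: (padic_ucM (padic_uc_cst _) (padic_uc_power hq)).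
by move=> m; rewrite -natrD !padic_power_nat exprD.
Qed.

Lemma padic_power_expr q w z : vabs (1 - q) < 1 ->
  padic_power (q ^+ w) z = padic_power q (w%:R * z).
Proof.
move=> hq; move: z; apply: padic_uc_ext_nat.
- exact/padic_uc_power/vabs_one_sub_expr.
- have := padic_uc_affine 0 w%:R (padic_uc_power hq).
  by under eq_fun do rewrite add0r.
by move=> m; rewrite -natrM !padic_power_nat exprM.
Qed.

Lemma padic_uc_qnumber q : vabs (1 - q) < 1 -> padic_uc (qnumber (M := M) q).
Proof.
move=> hq; rewrite /qnumber; case: eqP => _; first exact: padic_uc_to_Cp.
apply: (padic_ucM _ (padic_uc_cst _)); apply: padic_ucD (padic_uc_cst _) _.
rewrite (_ : (fun x => _) = (fun x => -1 * padic_power q x)).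
  exact: (padic_ucM (padic_uc_cst _) (padic_uc_power hq)).
by apply/funext => x; rewrite mulN1r.
Qed.

Lemma qnumber_natD q n z : vabs (1 - q) < 1 ->
  qnumber q (n%:R + z) = qnumber q n%:R + q ^+ n * qnumber q z.
Proof.
move=> hq; rewrite /qnumber; have [->|q1] := eqVneq q 1.
  by rewrite padic_int_to_CpD expr1n mul1r.
rewrite padic_power_natD // padic_power_nat.
have q1' : 1 - q != 0 by rewrite subr_eq0 eq_sym.
by field.
Qed.

Lemma qnumber_natM q w z : vabs (1 - q) < 1 ->
  qnumber q (w%:R * z) = qnumber q w%:R * qnumber (q ^+ w) z.
Proof.
move=> hq; rewrite /qnumber; have [->|q1] := eqVneq q 1.
  by rewrite expr1n eqxx padic_int_to_CpM.
rewrite padic_power_nat -padic_power_expr //.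
have q1' : 1 - q != 0 by rewrite subr_eq0 eq_sym.
have [qw|qw] := eqVneq (q ^+ w) 1; last first.
  have qw' : 1 - q ^+ w != 0 by rewrite subr_eq0 eq_sym.
  by field; rewrite q1' qw'.
(* Here [q] is a root of unity other than 1. Both sides vanish: on the right [[w]_q = 0], on the
   left the numerator is [1 - 1 ^ z]. *)
rewrite qw; suff -> : padic_power (1 : Cp) z = 1 by rewrite subrr !mul0r.
move: z; apply: padic_uc_ext_nat (padic_uc_cst 1) _.
  by apply: padic_uc_power; rewrite subrr vabs0.
by move=> n; rewrite padic_power_nat expr1n.
Qed.

(** * The fermionic integral *)

Definition alt_sum f n := \sum_(0 <= y < n) f y%:R * (-1) ^+ y.

Lemma sum_signs (A : nzRingType) w : \sum_(0 <= a < w) (-1) ^+ a = (odd w)%:R :> A.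
Proof.
elim: w => [|w IH]; first by rewrite big_nil.
by rewrite big_nat_recr //= IH -signr_odd; case: (odd w); rewrite ?addrN ?add0r.
Qed.

(** Cut the range into [w] blocks of length [p ^ N]: block [a] repeats the first one up to the sign
    [(-1) ^ (a * p ^ N)] and an error of at most [e]. With [w = p] this gives convergence, with
    general odd [w] the splitting of the integral. *)
Lemma alt_sum_blocks f e N w : 0 <= e ->
  (forall x u, vabs (f (x + (p ^ N)%:R * u) - f x) <= e) ->
  vabs (alt_sum f (w * p ^ N)
        - (\sum_(0 <= a < w) (-1) ^+ (a * p ^ N)) * alt_sum f (p ^ N)) <= e.
Proof.
move=> e0 fN; rewrite /alt_sum big_nat_mul /= big_distrl /= -sumrB.
apply: vabs_sum_le => // a _.
rewrite -{1}[(a * p ^ N)%N]add0n big_addn mulSn addnK big_distrr /= -sumrB.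
apply: vabs_sum_le => // y _.
have -> : f (y + a * p ^ N)%:R * (-1) ^+ (y + a * p ^ N) -
    (-1) ^+ (a * p ^ N) * (f y%:R * (-1) ^+ y) =
    (f (y%:R + (p ^ N)%:R * a%:R) - f y%:R) * (-1) ^+ (y + a * p ^ N).
  by rewrite -natrM -natrD [(p ^ N * a)%N]mulnC exprD; ring.
by rewrite vabsM vabs_sign mulr1.
Qed.

Lemma sum_signs_odd (A : nzRingType) w N : odd p -> odd w ->
  \sum_(0 <= a < w) (-1) ^+ (a * p ^ N) = 1 :> A.
Proof.
move=> op ow; rewrite (eq_bigr (fun a => (-1) ^+ a)).
  by rewrite sum_signs ow.
by move=> a _; rewrite -signr_odd oddM oddX op orbT andbT signr_odd.
Qed.

(** Taking [p] blocks, whose signs add up to 1, bounds the difference of consecutive partial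
    sums. *)
Lemma alt_sum_cvg_odd f : odd p -> padic_uc f ->
  vcvg (fun N => alt_sum f (p ^ N)) (fermionic_integral f).
Proof.
move=> op fu; have [l fl] : exists l, vcvg (fun N => alt_sum f (p ^ N)) l.
  apply: vcauchy_cvg => e e0; have [N NP] := fu _ e0; exists N => n Nn.
  have := alt_sum_blocks p (ltW e0) (padic_uc_mono Nn NP).
  by rewrite sum_signs_odd // mul1r -expnS.
by rewrite /fermionic_integral (vcvg_limn fl).
Qed.

(* For [p = 2] the partial sums satisfy [S (N + 1) = 2 * S N + o(1)] with
   [|2| < 1]. *)
Lemma alt_sum_cvg_even f : ~~ odd p -> padic_uc f ->
  vcvg (fun N => alt_sum f (p ^ N)) 0.
Proof.
move=> ep fu e e0.
(* The successor excludes the odd number [p ^ 0]: for [n >= N] the power [p ^ n] is even and all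
   block signs are 1. *)
have [N0 N0P] := fu _ e0; pose N := N0.+1; pose S n := alt_sum f (p ^ n).
have NP := padic_uc_mono (leqnSn N0) N0P.
have step n : (N <= n)%N -> vabs (S n.+1 - p%:R * S n) <= e.
  move=> Nn; have := alt_sum_blocks p (ltW e0) (padic_uc_mono Nn NP).
  rewrite -expnS (eq_bigr (fun=> 1)) => [|a _]; last first.
    by rewrite -signr_odd oddM oddX (negPf ep) orbF -leqn0 leqNgt (leq_trans _ Nn) //= andbF.
  by rewrite sumr_const_nat subn0.
(* Each step multiplies by [p], which shrinks the value, and adds an error of at most [e]; with a
   maximum in place of a sum these errors do not accumulate. *)
have S_le k : vabs (S (N + k)%N) <= Num.max (vabs (p%:R : Cp) ^+ k * vabs (S N)) e.
  elim: k => [|k IH]; first by rewrite addn0 expr0 mul1r le_max lexx.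
  rewrite addnS -[S _.+1](subrK (p%:R * S (N + k)%N)); apply: vabsD_le.
    by rewrite le_max step ?orbT // leq_addr.
  rewrite vabsM; have [IH'|IH'] := leP (vabs (S (N + k)%N)) e.
    rewrite le_max; apply/orP; right; apply: le_trans IH'.
    by rewrite ler_piMl ?vabs_ge0 // ltW // vabs_Cp_p_lt1.
  rewrite le_max; apply/orP; left; rewrite exprS -mulrA ler_wpM2l ?vabs_ge0 //.
  by move: IH; rewrite le_max leNgt => /orP[|]; rewrite ?leNgt ?IH'.
have b0 : 0 < vabs (S N) + 1 by rewrite ltr_wpDl ?vabs_ge0.
have [K KP] := geometric_small (vabs_ge0 _) vabs_Cp_p_lt1 (divr_gt0 e0 b0).
exists (N + K)%N => n NKn; rewrite subr0.
have Nn : (N <= n)%N := leq_trans (leq_addr _ _) NKn.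
rewrite -/(S n) -(subnKC Nn); apply: le_trans (S_le _) _; rewrite ge_max lexx andbT.
apply: (@le_trans _ _ (e / (vabs (S N) + 1) * (vabs (S N) + 1))).
  by rewrite ler_pM ?exprn_ge0 ?vabs_ge0 ?KP ?leq_subRL // lerDl.
by rewrite divfK // gt_eqF.
Qed.

Lemma fermionic_integral_even f : ~~ odd p -> padic_uc f -> fermionic_integral f = 0.
Proof. by move=> ep fu; apply: vcvg_limn; apply: alt_sum_cvg_even. Qed.

Lemma alt_sum_cvg f : padic_uc f ->
  vcvg (fun N => alt_sum f (p ^ N)) (fermionic_integral f).
Proof.
move=> fu; have [op|ep] := boolP (odd p); first exact: alt_sum_cvg_odd.
by rewrite fermionic_integral_even //; apply: alt_sum_cvg_even.
Qed.

Lemma fermionic_integral_sum (I : Type) (s : seq I) (c : I -> Cp) (F : I -> Zp -> Cp) :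
  (forall i, padic_uc (F i)) ->
  fermionic_integral (fun y => \sum_(i <- s) c i * F i y)
  = \sum_(i <- s) c i * fermionic_integral (F i).
Proof.
move=> Fu; apply: vcvg_limn.
apply: eq_vcvg (vcvg_sum s (fun i => vcvgZ (c i) (alt_sum_cvg (Fu i)))) => N.
rewrite /alt_sum; under eq_bigr do rewrite big_distrr /=.
rewrite exchange_big /=; apply: eq_bigr => y _; rewrite big_distrl /=.
by apply: eq_bigr => i _; rewrite mulrA.
Qed.

(** Signs have absolute value 1, so the same bound holds for all partial sums. It serves to show
    that an integral depends continuously on a parameter. *)
Lemma fermionic_integral_dist f g e : 0 < e -> padic_uc f -> padic_uc g ->
  (forall y, vabs (f y - g y) <= e) ->
  vabs (fermionic_integral f - fermionic_integral g) <= e.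
Proof.
move=> e0 fu gu fg; apply: (vcvg_dist_le e0 _ (alt_sum_cvg fu) (alt_sum_cvg gu)).
exists 0%N => N _; rewrite /alt_sum -sumrB vabs_sum_le ?ltW // => y _.
by rewrite -mulrBl vabsM vabs_sign mulr1.
Qed.

(** For odd [p], the alternating sum of length [w * p ^ n] is arranged in two ways: [w] blocks of
    length [p ^ n] lead to the left-hand side, residue classes modulo [w] to the right-hand side.
    For even [p] both sides are 0. *)
Lemma fermionic_integral_split f w : padic_uc f -> odd w ->
  fermionic_integral f
  = \sum_(0 <= k < w) (-1) ^+ k * fermionic_integral (fun y => f (k%:R + w%:R * y)).
Proof.
move=> fu ow; have fk k := padic_uc_affine k%:R w%:R fu.
have [op|ep] := boolP (odd p); last first.
  rewrite fermionic_integral_even // big1 // => k _.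
  by rewrite fermionic_integral_even // mulr0.
apply: vcvg_uniq (alt_sum_cvg fu) _.
apply: vcvg_near (vcvg_sum _ (fun k => vcvgZ ((-1) ^+ k) (alt_sum_cvg (fk k)))).
move=> e e0; have [N NP] := fu _ e0; exists N => n Nn.
have := alt_sum_blocks w (ltW e0) (padic_uc_mono Nn NP).
rewrite sum_signs_odd // mul1r vabs_distC; congr (vabs (_ - _) <= _).
(* Indices are now written [k + w y] with [k < w]; as [w] is odd, the sign [(-1) ^ (w y)] equals
   [(-1) ^ y]. *)
rewrite /alt_sum mulnC big_nat_mul /=; under [RHS]eq_bigr do rewrite big_distrr /=.
rewrite exchange_big /=; apply: eq_bigr => y _.
rewrite -{1}[(y * w)%N]add0n big_addn mulSn addnK; apply: eq_bigr => k _.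
rewrite natrD natrM [y%:R * _]mulrC exprD.
have -> : (-1) ^+ (y * w) = (-1) ^+ y :> Cp.
  by rewrite -signr_odd oddM ow andbT signr_odd.
by ring.
Qed.

(** * The symmetric form of the identity *)

Definition shifted_integral w g z := fermionic_integral (fun y => g (z + w%:R * y)).

Lemma padic_uc_shifted_integral w g : padic_uc g -> padic_uc (shifted_integral w g).
Proof.
move=> gu e e0; have [N NP] := gu _ e0; exists N => x u.
apply: (fermionic_integral_dist e0); try exact: padic_uc_affine.
by move=> y; rewrite addrAC.
Qed.

Lemma padic_uc_iter_shifted r w g : padic_uc g -> padic_uc (iter r (shifted_integral w) g).
Proof. by move=> gu; elim: r => //= r IH; apply: padic_uc_shifted_integral. Qed.

(** The last coordinate is the outermost variable; peeling it off gives one application of the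
    operator, the factor [w] becoming its step. *)
Lemma iterated_integral_shifted r w g z :
  iterated_integral (fun y : r.-tuple Zp => g (w%:R * (z + \sum_(i < r) tnth y i)))
  = iter r (shifted_integral w) g (w%:R * z).
Proof.
elim: r z => [|r IH] z /=; first by rewrite big_ord0 addr0.
congr fermionic_integral; apply/funext => y; rewrite -mulrDr -IH.
congr iterated_integral; apply/funext => t; congr (g (_ * _)).
rewrite big_ord_recr /= -addrA [y + _]addrC; congr (_ + (_ + _)).
  by apply: eq_bigr => i _; rewrite !(tnth_nth 0) /= nth_rcons size_tuple ltn_ord.
by rewrite (tnth_nth 0) /= nth_rcons size_tuple ltnn eqxx.
Qed.

(** Each integral commutes with the finite sum, uniform continuity of the inner iterates ensuring
    that the limits exist. *)
Lemma iter_shifted_sum r w (I : Type) (s : seq I) (c : I -> Cp) (F : I -> Zp -> Cp) z :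
  (forall i, padic_uc (F i)) ->
  iter r (shifted_integral w) (fun y => \sum_(i <- s) c i * F i y) z
  = \sum_(i <- s) c i * iter r (shifted_integral w) (F i) z.
Proof.
move=> Fu; elim: r z => [//|r IH] z /=.
rewrite /shifted_integral -fermionic_integral_sum // => [|i].
  by congr fermionic_integral; apply/funext => y; rewrite IH.
exact/padic_uc_affine/padic_uc_iter_shifted.
Qed.

Lemma iter_shifted_scale r w c g z : padic_uc g ->
  iter r (shifted_integral w) (fun y => c * g y) z
  = c * iter r (shifted_integral w) g z.
Proof.
move=> gu; have := @iter_shifted_sum r w unit [:: tt] (fun=> c) (fun=> g) z (fun=> gu).
rewrite big_seq1 => <-; congr (iter _ _ _ z).
by apply/funext => y; rewrite big_seq1.
Qed.

Lemma iterated_integral_scale r c g z : padic_uc g ->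
  c * iterated_integral (fun y : r.-tuple Zp => g (z + \sum_(i < r) tnth y i))
  = iterated_integral (fun y : r.-tuple Zp => c * g (z + \sum_(i < r) tnth y i)).
Proof.
(* The form [1 * z] presents the integral as an iterate of [shifted_integral 1], which commutes with
   scalars. *)
move=> gu; rewrite -[z]mul1r.
have E f : iterated_integral (fun y : r.-tuple Zp => f (1 * z + \sum_(i < r) tnth y i))
         = iter r (shifted_integral 1) f (1 * z).
  rewrite -(iterated_integral_shifted r 1 f); congr iterated_integral.
  by apply/funext => y; rewrite !mul1r.
by rewrite E (E (fun y => c * g y)) iter_shifted_scale.
Qed.

Lemma iter_shifted_translate r w c g z :
  iter r (shifted_integral w) (fun y => g (c + y)) z
  = iter r (shifted_integral w) g (c + z).
Proof.
elim: r z => [//|r IH] z /=; congr fermionic_integral.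
by apply/funext => y; rewrite IH addrA.
Qed.

(** The one-variable operator whose [r]-th iterate carries out both the [r]-fold sum of [Tsum] and
    the [r]-fold integral of [qEuler]. *)
Definition alternating_integral w1 w2 g z :=
  \sum_(0 <= j < w1) (-1) ^+ j * shifted_integral w1 g (z + w2%:R * j%:R).

Lemma padic_uc_alternating_integral w1 w2 g :
  padic_uc g -> padic_uc (alternating_integral w1 w2 g).
Proof.
move=> gu; apply: padic_uc_sum => j; apply: (padic_ucM (padic_uc_cst _)).
have := padic_uc_affine (w2%:R * j%:R) 1 (padic_uc_shifted_integral w1 gu).
by under eq_fun do rewrite mul1r addrC.
Qed.

(* Splitting the integral over the residues mod [w2] turns the alternating sum
   of length [w1] into a double sum that is symmetric in [w1] and [w2]. *)
Lemma alternating_integralC w1 w2 g : odd w1 -> odd w2 -> padic_uc g ->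
  alternating_integral w1 w2 g = alternating_integral w2 w1 g.
Proof.
suff split v1 v2 z : odd v1 -> odd v2 -> padic_uc g ->
    alternating_integral v1 v2 g z =
    \sum_(0 <= j < v1) \sum_(0 <= k < v2) (-1) ^+ j * (-1) ^+ k *
      shifted_integral (v1 * v2) g (z + v2%:R * j%:R + v1%:R * k%:R).
  move=> o1 o2 gu; apply/funext => z; rewrite !split // exchange_big /=.
  apply: eq_bigr => k _; apply: eq_bigr => j _.
  by rewrite [(w1 * w2)%N]mulnC mulrC [in RHS]mulrC; congr (shifted_integral _ _ _ * _);
    [rewrite addrAC | rewrite mulrC].
move=> o1 o2 gu; apply: eq_bigr => j _.
rewrite /shifted_integral.
rewrite (fermionic_integral_split (padic_uc_affine _ _ gu) o2) big_distrr /=.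
apply: eq_bigr => k _; rewrite -mulrA; congr (_ * (_ * fermionic_integral _)).
by apply/funext => y; rewrite mulrDr addrA natrM mulrA.
Qed.

Lemma iter_alternatingC r w1 w2 g : odd w1 -> odd w2 -> padic_uc g ->
  iter r (alternating_integral w1 w2) g = iter r (alternating_integral w2 w1) g.
Proof.
move=> o1 o2 gu; elim: r => //= r ->; apply: alternating_integralC => //.
by elim: r => //= r IH; apply: padic_uc_alternating_integral.
Qed.

(** * Expansion of the iterated operator over index vectors *)

(** The bijection [h] prepends [a] to a vector, and the summand sees only the total of the
    coordinates. *)
Lemma sum_ffun_recl (V : nmodType) r w (phi : nat -> V) :
  \sum_(j : {ffun 'I_r.+1 -> 'I_w}) phi (\sum_(k < r.+1) j k)%N
  = \sum_(a < w) \sum_(j : {ffun 'I_r -> 'I_w}) phi (a + \sum_(k < r) j k)%N.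
Proof.
rewrite pair_big /=.
pose h (aj : 'I_w * {ffun 'I_r -> 'I_w}) : {ffun 'I_r.+1 -> 'I_w} :=
  [ffun i : 'I_r.+1 => oapp (fun k : 'I_r => aj.2 k) aj.1 (unlift ord0 i)].
rewrite (reindex h) /=.
  apply: eq_bigr => -[a j] _; congr phi; rewrite big_ord_recl ffunE unlift_none /=.
  by congr addn; apply: eq_bigr => k _; rewrite ffunE liftK.
exists (fun j => (j ord0, [ffun k : 'I_r => j (lift ord0 k)])).
  move=> [a j] _ /=; rewrite ffunE unlift_none /=; congr pair.
  by apply/ffunP => k; rewrite !ffunE liftK.
move=> j _; apply/ffunP => i; rewrite ffunE.
by case: unliftP => [k ->|->] //=; rewrite ffunE.
Qed.

(** Induction on [r]: linearity moves the outer integral past the sum over vectors of length [r],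
    and the outer index becomes their new first coordinate. *)
Lemma iter_alternatingE r w1 w2 g z : padic_uc g ->
  iter r (alternating_integral w1 w2) g z
  = \sum_(j : {ffun 'I_r -> 'I_w1}) (-1) ^+ (\sum_(k < r) j k)
      * iter r (shifted_integral w1) g (z + w2%:R * (\sum_(k < r) j k)%:R).
Proof.
move=> gu; elim: r z => [|r IH] z.
  (* For [r = 0] there is exactly one empty vector, so the sum has a single term. *)
  rewrite (eq_bigr (fun=> g z)) => [|j _]; last first.
    by rewrite big_ord0 expr0 mul1r mulr0 addr0.
  by rewrite sumr_const card_ffun [#|'I_0|]card_ord.
rewrite (sum_ffun_recl r w1 (fun m : nat => (-1) ^+ m
  * iter r.+1 (shifted_integral w1) g (z + w2%:R * m%:R))).
rewrite iterS /alternating_integral big_mkord; apply: eq_bigr => a _.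
rewrite {1}/shifted_integral.
under [in LHS]eq_fun do rewrite IH.
have Iu := padic_uc_iter_shifted r w1 gu.
rewrite fermionic_integral_sum => [|j]; last first.
  rewrite (_ : (fun y => _) = (fun y => iter r (shifted_integral w1) g
    (z + w2%:R * a%:R + w2%:R * (\sum_(k < r) j k)%:R + w1%:R * y))).
    exact: padic_uc_affine.
  by apply/funext => y; rewrite addrAC.
rewrite big_distrr; apply: eq_bigr => j _ /=; rewrite mulrA -exprD.
congr (_ * fermionic_integral _); apply/funext => y.
by rewrite natrD mulrDr addrAC !addrA.
Qed.

(* By the addition formula [[a + y]_q = [a]_q + q^a [y]_q], summing over [i]
   rebuilds the [n]-th power of [[w2 J + w1 w2 x + w1 Y]_q]. *)
Lemma sum_Tsum_qEuler r n w1 w2 q z : vabs (1 - q) < 1 ->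
  \sum_(i < n.+1) 'C(n, i)%:R * qnumber q (w1%:R : Zp) ^+ (n - i)
      * qnumber q (w2%:R : Zp) ^+ i
      * Tsum r n i (q ^+ w2) w1 * qEuler r (n - i) (q ^+ w1) (w2%:R * z)
  = iter r (alternating_integral w1 w2) (fun y => qnumber q y ^+ n) (w1%:R * (w2%:R * z)).
Proof.
move=> hq; set Z := w1%:R * (w2%:R * z).
have Gu m : padic_uc (fun y : Zp => qnumber q y ^+ m).
  exact/padic_ucX/padic_uc_qnumber.
(* The power of [[w1]_q] changes the base of the integrand from [q ^+ w1] to [q]. *)
pose I m := iter r (shifted_integral w1) (fun y => qnumber q y ^+ m) Z.
have IE m : qnumber q (w1%:R : Zp) ^+ m * qEuler r m (q ^+ w1) (w2%:R * z) = I m.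
  rewrite /qEuler (iterated_integral_scale _ _ (g := fun y => qnumber (q ^+ w1) y ^+ m)).
    rewrite /I /Z -iterated_integral_shifted; congr iterated_integral.
    by apply/funext => y; rewrite qnumber_natM // exprMn.
  exact/padic_ucX/padic_uc_qnumber/vabs_one_sub_expr.
rewrite iter_alternatingE //.
(* Likewise, with [s] the sum of the [j k], [[w2]_q ^ i] merges with the bracket of [Tsum] into
   [[w2 s]_q ^ i]. *)
transitivity (\sum_(i < n.+1) \sum_(j : {ffun 'I_r -> 'I_w1})
  (-1) ^+ (\sum_(k < r) j k) * ('C(n, i)%:R
    * qnumber q ((w2 * \sum_(k < r) j k)%:R : Zp) ^+ i
    * (q ^+ (w2 * \sum_(k < r) j k)) ^+ (n - i) * I (n - i)%N)).
  apply: eq_bigr => i _; rewrite -IE /Tsum big_distrr big_distrl /=.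
  apply: eq_bigr => j _; rewrite natrM qnumber_natM // exprMn.
  have -> : (q ^+ w2) ^+ ((n - i) * \sum_(k < r) j k)
          = (q ^+ (w2 * \sum_(k < r) j k)) ^+ (n - i).
    by rewrite -!exprM [((n - i) * _)%N]mulnC mulnA.
  by ring.
rewrite exchange_big; apply: eq_bigr => j _ /=; rewrite -big_distrr /=; congr (_ * _).
rewrite -natrM; set J := (w2 * _)%N; rewrite addrC.
(* For fixed [j], the sum over [i] moves under the integrals, where it is the binomial expansion of
   [([J]_q + q^J [y]_q)^n = [J + y]_q^n]. *)
rewrite -(iter_shifted_translate _ _ J%:R (fun y => qnumber q y ^+ n)).
rewrite -(iter_shifted_sum _ _ _ (fun i : 'I_n.+1 => 'C(n, i)%:R * qnumber q (J%:R : Zp) ^+ i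
    * (q ^+ J) ^+ (n - i)) (F := fun i y => qnumber q y ^+ (n - i))) //.
congr (iter _ _ _ _); apply/funext => y.
rewrite qnumber_natD // addrC exprDn; apply: eq_bigr => i _.
by rewrite exprMn -mulr_natl; ring.
Qed.

End PadicIntegers.

Unset Implicit Arguments.

Theorem theorem4 (R : realType) (p : nat) (p_prime : prime p)
    (M : padic_tower R p) (q : Cp M) (hq : vabs (1 - q) < 1)
    (r : nat) (r_gt0 : (0 < r)%N) (n : nat) (x : padic_int M)
    (w1 w2 : nat) (w1_odd : odd w1) (w2_odd : odd w2) :
  \sum_(i < n.+1) 'C(n, i)%:R
      * qnumber q w1%:R ^+ (n - i) * qnumber q w2%:R ^+ i
      * Tsum r n i (q ^+ w2) w1 * qEuler r (n - i) (q ^+ w1) (w2%:R * x)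
  = \sum_(i < n.+1) 'C(n, i)%:R
      * qnumber q w1%:R ^+ i * qnumber q w2%:R ^+ (n - i)
      * Tsum r n i (q ^+ w1) w2 * qEuler r (n - i) (q ^+ w2) (w1%:R * x).
Proof.
rewrite (sum_Tsum_qEuler p_prime) //.
(* Swapping the two bracket powers makes the right-hand side the left one with [w1] and [w2]
   exchanged. *)
under [RHS]eq_bigr => i _ do rewrite -(mulrA 'C(n, i)%:R) [qnumber q w1%:R ^+ i * _]mulrC mulrA.
(* Both iterates are evaluated at the same point, as [w1 (w2 x) = w2 (w1 x)]. *)
rewrite (sum_Tsum_qEuler p_prime) // [w1%:R * (_ * _)]mulrCA.
rewrite (iter_alternatingC p_prime) //.
exact/(padic_ucX p_prime)/padic_uc_qnumber.
Qed.
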